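(* Let $0<\alpha<1$ and let $n\in\mathbb{N}$ satisfy $n^{1-\alpha}>2$. Let $f\in C_B(\mathbb{R})$. Then for every $x\in\mathbb{R}$ $$\left|\overline{A_n}(f)(x)-f(x)\right|\le \omega\!\left(f,\frac1n+\frac{1}{n^{\alpha}}\right)+\frac{2\left(q+\frac1q\right)\|f\|_\infty}{B^{\beta(n^{1-\alpha}-1)}}=:E,$$ and $$\|\overline{A_n}(f)-f\|_\infty\le E.$$ Furthermore, if $f\in C_{UB}(\mathbb{R})$, then $\lim_{n\to\infty}\overline{A_n}(f)=f$ pointwise and uniformly on $\mathbb{R}$.
   Context: Fix real parameters $q>0$, $\beta>0$, $B>1$; $\mathbb{N}=\{1,2,3,\dots\}$. For $x\in\mathbb{R}$ and any $p>0$ put $$\nu_{p,\beta}(x)=\frac{1}{1+pB^{-\beta x}},\qquad G_{p,\beta}(x)=\tfrac12\big(\nu_{p,\beta}(x+1)-\nu_{p,\beta}(x-1)\big),\qquad \Psi(x)=\tfrac12\big(G_{q,\beta}(x)+G_{1/q,\beta}(x)\big).$$ $C_B(\mathbb{R})$ is the set of continuous bounded functions $f:\mathbb{R}\to\mathbb{R}$; $C_{UB}(\mathbb{R})$ is the set of uniformly continuous bounded functions on $\mathbb{R}$; $\|\cdot\|_\infty$ is the supremum norm on $\mathbb{R}$. The modulus of continuity is $\omega(f,\theta)=\sup\{|f(x)-f(y)|: x,y\in\mathbb{R},\ |x-y|\le\theta\}$ for $\theta>0$. Fix $r\in\mathbb{N}$ and weights $w_1,\dots,w_r\ge0$ with $\sum_{j=1}^r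 w_j=1$. For $n\in\mathbb{N}$ the quadrature type operator $\overline{A_n}$ is $$\overline{A_n}(f)(x)=\int_{-\infty}^{\infty}\left(\sum_{j=1}^r w_j\, f\!\left(\frac vn+\frac{j}{nr}\right)\right)\Psi(nx-v)\,dv .$$ *)

(* Defs.v *)
From HB Require Import structures.
From mathcomp Require Export all_boot all_order all_algebra.
From mathcomp Require Export all_classical all_reals all_analysis.
Import Order.TTheory GRing.Theory Num.Theory.
Import numFieldNormedType.Exports.

Set Implicit Arguments.
Unset Strict Implicit.
Unset Printing Implicit Defensive.

Local Open Scope classical_set_scope.
Local Open Scope ring_scope.

Definition nu (R : realType) (B beta p x : R) : R :=
  (1 + p * B `^ (- (beta * x)))^-1.

Definition G (R : realType) (B beta p x : R) : R :=
  2^-1 * (nu B beta p (x + 1) - nu B beta p (x - 1)).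

Definition Psi (R : realType) (B beta q x : R) : R :=
  2^-1 * (G B beta q x + G B beta q^-1 x).

Definition C_B (R : realType) : set (R -> R) :=
  [set f | continuous f /\ bounded_fun f].

Definition C_UB (R : realType) : set (R -> R) :=
  [set f | unif_continuous f /\ bounded_fun f].

(* The suprema below are taken in the extended reals, so that they are [+oo]
   (rather than a default real value) when the set is unbounded. *)
Definition supnorm (R : realType) (f : R -> R) : \bar R :=
  ereal_sup [set `|f x|%:E | x in [set: R]].

Definition modulus (R : realType) (f : R -> R) (theta : R) : \bar R :=
  ereal_sup [set `|f xy.1 - f xy.2|%:E
            | xy in [set xy : R * R | `|xy.1 - xy.2| <= theta]].

(* Only the values [w 1, ..., w r] of the weight sequence [w] are used. *)
Definition quadrature_op (R : realType) (B beta q : R) (r : nat) (w : nat -> R)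
    (n : nat) (f : R -> R) (x : R) : R :=
  \int[@lebesgue_measure R]_(v in [set: R])
    ((\sum_(1 <= j < r.+1) w j * f (v / n%:R + j%:R / (n%:R * r%:R)))
     * Psi B beta q (n%:R * x - v)).

(* Main.v *)
(* Put [c = beta * ln B].  Since [ln (expR (c * x) + p) / c] is an antiderivative
   of [nu B beta p], the kernel [Psi] is the derivative of an explicit function
   [K] increasing from 0 to 1, so [Psi (a - v)] is a probability density in [v],
   and its two tails beyond distance [T] from [a] have mass [1 - K T] and
   [K (- T)], together at most [(q + q^-1) * expR (- c * (T - 1))].  With
   [a = n * x] and [T = n `^ (1 - alpha)], the sample points of [f] differ from
   [x] by at most [n^-1 + T / n] on the central part, where the modulus of
   continuity applies; on the tails one uses [2 * supnorm f].  For uniform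
   convergence, [T] is chosen first, independently of [n]. *)
Require Import Defs.
From mathcomp Require Import measurable_realfun ring lra.
Import Order.TTheory GRing.Theory Num.Theory.
Import numFieldNormedType.Exports.

Local Open Scope classical_set_scope.
Local Open Scope ring_scope.

Section Quadrature.
Context {R : realType}.
Notation mu := (@lebesgue_measure R).

(** * Densities given through their distribution function, and means against them *)

Record is_density (k K : R -> R) : Prop := IsDensity {
  density_ge0 : forall x, 0 <= k x;
  density_continuous : continuous k;
  density_cdf : forall x : R, is_derive x (1 : R) K (k x);
  density_cvgy : K x @[x --> +oo] --> (1 : R);
  density_cvgNy : K x @[x --> -oo] --> (0 : R) }.

Lemma continuous_reflect (k : R -> R) (a : R) :
  continuous k -> continuous (fun v => k (a - v)).
Proof.
move=> ck v; apply: (@continuous_comp _ _ _ (fun v => a - v) k); last exact: ck.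
by apply: cvgB; [exact: cvg_cst|exact: cvg_id].
Qed.

Lemma is_derive_continuous (F : R -> R) (x d : R) :
  is_derive x 1 F d -> {for x, continuous F}.
Proof.
by move=> [dF _]; apply: differentiable_continuous; exact/derivable1_diffP.
Qed.

(** By the fundamental theorem of calculus: [- K (a - v)] is an antiderivative in [v] and tends to 0
    as [v] grows. The reflection turns the upper half-line in [v] into the lower tail of [K]. *)
Lemma integral_density_right (k K : R -> R) (a b : R) : is_density k K ->
  (\int[mu]_(v in `[b, +oo[) (k (a - v))%:E = (K (a - b))%:E)%E.
Proof.
move=> [k0 ck dK Ky KNy].
have dF (x : R) : is_derive x 1 (fun v => - K (a - v)) (k (a - x)).
  have : is_derive x 1 (K \o (fun v => a - v)) (k (a - x) * (0 - 1)).
    apply: is_derive1_comp.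
  move=> h; have := is_deriveN h; rewrite sub0r mulrN1 opprK; exact.
rewrite (@ge0_continuous_FTC2y _ _ (fun v => - K (a - v)) _ 0) ?sub0r//.
- by rewrite EFinN oppeK add0e.
- exact/continuous_subspaceT/continuous_reflect.
- rewrite -oppr0; apply: cvgN.
  apply: (cvg_comp _ _ _ KNy).
  apply/cvgrNyPle => A; near=> v; rewrite lerBlDr -lerBlDl.
    by near: v; apply: nbhs_pinfty_ge; exact: num_real.
- apply: cvg_at_right_filter; exact: is_derive_continuous _ _ _ (dF b).
- by move=> x _; rewrite derive1E; have [] := dF x.
Unshelve. all: by end_near. Qed.

(** Changing [v] to [- v] moves the integral to a half-line unbounded above, where [K (a + v)] is an
    antiderivative with limit 1. *)
Lemma integral_density_left (k K : R -> R) (a b : R) : is_density k K ->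
  (\int[mu]_(v in `]-oo, b]) (k (a - v))%:E = (1 - K (a - b))%:E)%E.
Proof.
move=> [k0 ck dK Ky KNy].
rewrite -{1}(opprK b) ge0_integration_by_substitutionNy//; last first.
  by apply: continuous_subspaceT; exact: continuous_reflect.
have dF (x : R) : is_derive x 1 (fun v => K (a + v)) (k (a + x)).
  have : is_derive x 1 (K \o (fun v => a + v)) (k (a + x) * (0 + 1)).
    apply: is_derive1_comp.
  by rewrite add0r mulr1.
under eq_integral do rewrite /= opprK.
rewrite (@ge0_continuous_FTC2y _ _ (fun v => K (a + v)) _ 1)//.
- apply: continuous_subspaceT => x.
  apply: (@continuous_comp _ _ _ (fun v => a + v) k); last exact: ck.
  by apply: cvgD; [exact: cvg_cst|exact: cvg_id].
- apply: (cvg_comp _ _ _ Ky).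
  apply/cvgryPge => A; near=> v; rewrite -lerBlDl.
  by near: v; apply: nbhs_pinfty_ge; exact: num_real.
- apply: cvg_at_right_filter; exact: is_derive_continuous _ _ _ (dF _).
- by move=> x _; rewrite derive1E; have [] := dF x.
Unshelve. all: by end_near. Qed.

Lemma measurable_density (k K : R -> R) (a : R) (D : set R) : is_density k K ->
  measurable_fun D (fun v => k (a - v)).
Proof.
move=> dk; apply: measurable_funTS; apply: continuous_measurable_fun.
by apply: continuous_reflect; exact: density_continuous _ _ dk.
Qed.

Lemma integral_density (k K : R -> R) (a : R) : is_density k K ->
  (\int[mu]_v (k (a - v))%:E = 1)%E.
Proof.
move=> dk; have := integral_density_left _ _ a 0 dk.
have := integral_density_right _ _ a 0 dk.
(* The endpoint 0 is dropped from the right half-line, which becomes the exact complement of []-oo,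
   0]]. *)
rewrite -integral_itv_obnd_cbnd; last first.
  by apply/measurable_EFinP; exact: measurable_density _ _ _ _ dk.
move=> hr hl; rewrite -(setUv `]-oo, (0:R)]) ge0_integral_setU//=.
- rewrite [X in (_ + X)%E](_ : _ = (K (a - 0))%:E).
    by rewrite hl -EFinD subrK.
  by rewrite -hr; congr integral; rewrite setCitvl.
- exact: measurableC.
- by apply/measurable_EFinP; exact: measurable_density _ _ _ _ dk.
- by move=> x _; rewrite lee_fin (density_ge0 _ _ dk).
- exact/disj_setPCl.
Qed.

Lemma integrable_density (k K : R -> R) (a : R) : is_density k K ->
  mu.-integrable setT (fun v => (k (a - v))%:E).
Proof.
move=> dk; apply/integrableP; split.
  by apply/measurable_EFinP; exact: measurable_density _ _ _ _ dk.
under eq_integral do rewrite gee0_abs ?lee_fin ?(density_ge0 _ _ dk)//.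
by rewrite (integral_density _ _ a dk) ltry.
Qed.

(** The mass being 1, [y] can be moved under the integral. Then [|S v - y|] costs at most [om] near
    [a] and at most [M] on the two tails, whose masses are [1 - K T] and [K (- T)]. *)
Lemma density_approx (k K S : R -> R) (a y T om M : R) : is_density k K ->
  measurable_fun setT S -> 0 <= om ->
  (forall v, `|a - v| <= T -> `|S v - y| <= om) ->
  (forall v, `|S v - y| <= M) ->
  `| \int[mu]_v (S v * k (a - v)) - y | <= om + M * (K (- T) + (1 - K T)).
Proof.
move=> dk mS om0 Sc SM.
have M0 : 0 <= M by apply: le_trans (SM 0).
have k0 v : 0 <= k (a - v) by exact: density_ge0 _ _ dk _.
have ik := integrable_density _ _ a dk.
have mk (D : set R) : measurable_fun D (fun v : R => k (a - v)).
  exact: measurable_density _ _ _ _ dk.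
have mSy : measurable_fun setT (fun v : R => S v - y).
  by apply: (measurable_funB mS); exact: measurable_cst.
have mSk : measurable_fun setT (fun v : R => (S v - y) * k (a - v)).
  exact: (measurable_funM mSy (mk _)).
(* Integrability comes from domination by [M] times the density. *)
have iSy : mu.-integrable setT (EFin \o (fun v => (S v - y) * k (a - v))).
  apply: (le_integrable _ _ _ (integrableZl _ M ik)) => //.
  - exact/measurable_EFinP.
  - move=> v _; rewrite /= lee_fin !normrM (ger0_norm M0).
    by rewrite ler_wpM2r.
have iy : mu.-integrable setT (EFin \o (fun v => y * k (a - v))).
  exact: (integrableZl _ y ik).
have -> : \int[mu]_v (S v * k (a - v)) - y = \int[mu]_v ((S v - y) * k (a - v)).
  have -> : \int[mu]_v (S v * k (a - v)) =
            \int[mu]_v ((S v - y) * k (a - v) + y * k (a - v)).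
    by apply: eq_Rintegral => v _; rewrite mulrBl subrK.
  rewrite RintegralD// RintegralZl//.
  by rewrite {2}/Rintegral (integral_density _ _ a dk) /= mulr1 addrK.
apply: (le_trans (le_normr_Rintegral _ iSy)) => //.
rewrite -lee_fin /Rintegral fineK; last first.
  by apply: integrable_fin_num => //; exact: integrable_norm iSy.
pose L := `]-oo, a - T]; pose U := `[a + T, +oo[.
have mkE (D A : set R) : measurable A ->
    measurable_fun D (((fun v => (k (a - v))%:E) \_ A)).
  move=> mA; apply: measurable_funTS; apply/(measurable_restrictT _ _).1 => //.
  exact/measurable_EFinP.
have kE0 (A : set R) v : (0 <= ((fun v => (k (a - v))%:E) \_ A) v)%E.
  by apply: erestrict_ge0 => t _; rewrite lee_fin.
have mkT : measurable_fun setT (fun v : R => (k (a - v))%:E) by exact/measurable_EFinP.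
(* The majorant is [om] times the density on the whole line, plus [M] times its restrictions to both
   tails; any overlap only enlarges it. *)
apply: (@le_trans _ _ (\int[mu]_v (om%:E * (k (a - v))%:E +
   M%:E * (((fun v => (k (a - v))%:E) \_ [set` L]) v +
                ((fun v => (k (a - v))%:E) \_ [set` U]) v)))%E).
  apply: ge0_le_integral => //.
  - by apply/measurable_EFinP; apply: measurableT_comp.
  - apply: emeasurable_funD.
      by apply: measurable_funeM; exact: mkT.
    by apply: measurable_funeM; apply: emeasurable_funD; exact: mkE.
  - move=> v _; rewrite normrM (ger0_norm (k0 v)).
    have [vT|] := leP `|a - v| T.
      rewrite -[leLHS]adde0; apply: leeD.
        by rewrite -EFinM lee_fin ler_wpM2r// Sc.
      by rewrite mule_ge0// ?lee_fin// adde_ge0.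
    rewrite ltr_normr => vT.
    rewrite -[leLHS]add0e; apply: leeD.
      by rewrite mule_ge0// lee_fin.
    rewrite EFinM; apply: lee_pmul; rewrite ?lee_fin//.
    case/orP : vT => vT.
      rewrite -[leLHS]adde0; apply: leeD => //.
      by rewrite patchT// inE /= in_itv/=; lra.
    rewrite -[leLHS]add0e; apply: leeD => //.
    by rewrite patchT// inE /= in_itv/= andbT; lra.
rewrite ge0_integralD//; first last.
  - by apply: measurable_funeM; apply: emeasurable_funD; exact: mkE.
  - by move=> v _; rewrite mule_ge0// ?lee_fin// adde_ge0.
  - by apply: measurable_funeM; exact: mkT.
  - by move=> v _; rewrite mule_ge0// lee_fin.
rewrite ge0_integralZl//; last by move=> v _; rewrite lee_fin.
rewrite (integral_density _ _ a dk) mule1 ge0_integralZl//; first last.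
  - by move=> v _; rewrite adde_ge0.
  - by apply: emeasurable_funD; exact: mkE.
rewrite ge0_integralD//; [|exact: mkE|exact: mkE].
rewrite -!integral_mkcond (integral_density_left k K) // (integral_density_right k K) //.
rewrite lee_fin.
(* Because of the reflection, [L] contributes [1 - K T] and [U] contributes [K (- T)]. *)
rewrite (_ : a - (a - T) = T); last by lra.
by rewrite (_ : a - (a + T) = - T); [rewrite [1 - _ + _]addrC|lra].
Qed.

(** * The mean of [nu] over [[x - 1, x + 1]]: distribution function of [G] and its tails *)

Definition Gcdf (c p x : R) : R :=
  (ln (expR (c * (x + 1)) + p) - ln (expR (c * (x - 1)) + p)) / (2 * c).

Lemma nuE (B beta p x : R) : 1 < B ->
  nu B beta p x = (1 + p * expR (- (beta * ln B * x)))^-1.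
Proof.
move=> B1; rewrite /nu /powR gt_eqF ?(lt_trans ltr01)//.
by congr (1 + p * expR _)^-1; ring.
Qed.

(** Both tails of [Gcdf] reduce to this expression. The upper bound combines [ln (1 + t) <= t] with
    [1 - expR (- (2 * c)) <= 2 * c]; the latter cancels the divisor [2 * c]. *)
Lemma ln_ratio_bounds (c u : R) : 0 < c -> 0 <= u ->
  0 <= (ln (1 + u) - ln (1 + u * expR (- (2 * c)))) / (2 * c) <= u.
Proof.
move=> c0 u0; set s := expR _.
have s0 : 0 < s by exact: expR_gt0.
have s1 : s <= 1 by rewrite -expR0 ler_expR; lra.
have sc : 1 - 2 * c <= s by apply: le_trans (expR_ge1Dx _); lra.
have us0 : 0 <= u * s by rewrite mulr_ge0// ltW.
have us : u * s <= u by rewrite ler_piMr.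
have c20 : 0 < 2 * c by lra.
apply/andP; split.
  by rewrite divr_ge0 ?(ltW c20)// subr_ge0 ler_ln ?posrE; lra.
rewrite ler_pdivrMr// -ln_div ?posrE; [|lra|lra].
have -> : (1 + u) / (1 + u * s) = 1 + u * (1 - s) / (1 + u * s) by field; lra.
have t0 : 0 <= u * (1 - s) by rewrite mulr_ge0//; lra.
apply: le_trans (le_ln1Dx _) _.
  by apply: (@lt_le_trans _ _ 0); rewrite ?ltrN10// divr_ge0//; lra.
rewrite ler_pdivrMr; last lra.
apply: (@le_trans _ _ (u * (2 * c))); first by rewrite ler_wpM2l//; lra.
by rewrite ler_peMr ?mulr_ge0//; lra.
Qed.

(** Factoring [p] out of each logarithm cancels [ln p] and leaves [ln_ratio_bounds] with
    [u = p^-1 * expR (c * (x + 1))]. *)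
Lemma Gcdf_lower (c p x : R) : 0 < c -> 0 < p ->
  0 <= Gcdf c p x <= p^-1 * expR (c * (x + 1)).
Proof.
move=> c0 p0; have := @ln_ratio_bounds c (p^-1 * expR (c * (x + 1))) c0.
have lnE (t : R) : 0 < t -> ln (t + p) = ln p + ln (1 + p^-1 * t).
  move=> t0; rewrite -lnM ?posrE//; last by rewrite addr_gt0 ?mulr_gt0 ?invr_gt0.
  by congr ln; field; lra.
rewrite /Gcdf !lnE ?expR_gt0// -mulrA -expRD.
rewrite (_ : c * (x + 1) + - (2 * c) = c * (x - 1)); last by ring.
rewrite opprD addrACA subrr add0r; apply.
by rewrite mulr_ge0 ?expR_ge0// invr_ge0 ltW.
Qed.

(** Factoring [expR t] out of [expR t + p] leaves linear terms that differ by [2 * c] and so account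
    for the 1; the rest is [ln_ratio_bounds] with [u = p * expR (- (c * (x - 1)))]. *)
Lemma Gcdf_upper (c p x : R) : 0 < c -> 0 < p ->
  0 <= 1 - Gcdf c p x <= p * expR (- (c * (x - 1))).
Proof.
move=> c0 p0; have := @ln_ratio_bounds c (p * expR (- (c * (x - 1)))) c0.
have lnE (t : R) : ln (expR t + p) = t + ln (1 + p * expR (- t)).
  rewrite -{2}(expRK t) -lnM ?posrE ?expR_gt0//; last first.
    by rewrite addr_gt0 ?mulr_gt0 ?expR_gt0.
  by congr ln; rewrite mulrDr mulr1 mulrCA expRxMexpNx_1 mulr1.
rewrite /Gcdf !lnE -mulrA -expRD.
rewrite (_ : - (c * (x - 1)) + - (2 * c) = - (c * (x + 1))); last by ring.
rewrite (_ : forall u v : R, 1 - (c * (x + 1) + v - (c * (x - 1) + u)) / (2 * c)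
  = (u - v) / (2 * c)); last by move=> u v; field; lra.
by apply; rewrite mulr_ge0 ?expR_ge0// ltW.
Qed.

(** [ln (expR (c * y) + p)] has derivative [c * nu B beta p y]; the shifts by 1 and -1 give the two
    terms of [G], and the divisor [2 * c] supplies its factor one half. *)
Lemma is_derive_Gcdf (B beta p x : R) : 1 < B -> 0 < beta -> 0 < p ->
  is_derive x 1 (Gcdf (beta * ln B) p) (G B beta p x).
Proof.
move=> B1 beta0 p0; set c := beta * ln B.
have c0 : 0 < c by rewrite mulr_gt0// ln_gt0.
have dL (h : R) : is_derive x 1 (fun y => ln (expR (c * (y + h)) + p))
      (c * nu B beta p (x + h)).
  have pos : 0 < expR (c * (x + h)) + p by rewrite addr_gt0 ?expR_gt0.
  have d1 : is_derive x 1 (fun y : R => c * (y + h)) c.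
    by apply: is_derive_eq; rewrite addr0 /GRing.scale /= mulr1.
  have d2 : is_derive x 1 (fun y : R => expR (c * (y + h)) + p) (c * expR (c * (x + h))).
    have := @is_derive1_comp _ expR _ _ _ _ (is_derive_expR _) d1.
    move=> h'; have := is_deriveD h' (is_derive_cst p x 1).
    by rewrite addr0 mulrC; apply.
  have h' := @is_derive1_comp _ (@ln R) (fun y => expR (c * (y + h)) + p) x _ _
    (is_derive1_ln pos) d2.
  apply: (is_derive_eq h').
  rewrite nuE// -/c expRN.
  have := expR_gt0 (c * (x + h)); set e := expR _ => e0.
  by field; rewrite ?gt_eqF// addr_gt0.
have := is_deriveB (dL 1) (dL (-1)).
move=> /(is_deriveZ ((2 * c)^-1)) h.
rewrite (_ : Gcdf c p = (fun y => (2 * c)^-1 *: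
  (ln (expR (c * (y + 1)) + p) - ln (expR (c * (y - 1)) + p)))); last first.
  by apply/funext => y; rewrite /Gcdf mulrC.
apply: (is_derive_eq h).
by rewrite /G /GRing.scale /=; field; lra.
Qed.

(** * Continuity and nonnegativity of [G] *)

Lemma nu_continuous (B beta p : R) : 1 < B -> 0 < p -> continuous (nu B beta p).
Proof.
move=> B1 p0 x.
rewrite (_ : nu B beta p = fun x => (1 + p * expR (- (beta * ln B * x)))^-1); last first.
  by apply/funext => y; rewrite nuE.
apply: cvgV; first by rewrite gt_eqF// addr_gt0 ?mulr_gt0 ?expR_gt0.
apply: cvgD; first exact: cvg_cst.
apply: cvgMr; apply: (@continuous_comp _ _ _ (fun x => - (beta * ln B * x)) expR).
  by apply: cvgN; apply: cvgMr; exact: cvg_id.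
exact: continuous_expR.
Qed.

Lemma nu_le (B beta p x y : R) : 1 < B -> 0 < beta -> 0 < p -> x <= y ->
  nu B beta p x <= nu B beta p y.
Proof.
move=> B1 b0 p0 xy; rewrite !nuE// lef_pV2 ?posrE ?addr_gt0 ?mulr_gt0 ?expR_gt0//.
rewrite lerD2l ler_pM2l// ler_expR lerN2 ler_pM2l// mulr_gt0// ln_gt0//.
Qed.

Lemma G_ge0 (B beta p x : R) : 1 < B -> 0 < beta -> 0 < p -> 0 <= G B beta p x.
Proof.
move=> B1 b0 p0; rewrite /G mulr_ge0 ?invr_ge0// subr_ge0 nu_le//; lra.
Qed.

Lemma G_continuous (B beta p : R) : 1 < B -> 0 < p -> continuous (G B beta p).
Proof.
move=> B1 p0 x; apply: cvgMr.
by apply: cvgB; apply: (@continuous_comp _ _ _ (fun x : R => _) (nu B beta p));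
  [apply: cvgD; [exact: cvg_id|exact: cvg_cst]|exact: nu_continuous
  |apply: cvgB; [exact: cvg_id|exact: cvg_cst]|exact: nu_continuous].
Qed.

(** * [Psi] as a density with exponential tails *)

Definition Psicdf (c q x : R) : R := 2^-1 * (Gcdf c q x + Gcdf c q^-1 x).

(** Averaging over [p = q] and [p = q^-1] symmetrizes the constant: the factor [p^-1] here and the
    factor [p] in the upper tail both average to half of [q + q^-1]. *)
Lemma Psicdf_lower (c q x : R) : 0 < c -> 0 < q ->
  0 <= Psicdf c q x <= 2^-1 * (q + q^-1) * expR (c * (x + 1)).
Proof.
move=> c0 q0; have qV0 : 0 < q^-1 by rewrite invr_gt0.
have /andP[a1 a2] := Gcdf_lower _ _ x c0 q0.
have /andP[b1 b2] := Gcdf_lower _ _ x c0 qV0.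
rewrite invrK in b2; rewrite /Psicdf.
by apply/andP; split; [|rewrite -mulrA mulrDl]; lra.
Qed.

Lemma Psicdf_upper (c q x : R) : 0 < c -> 0 < q ->
  0 <= 1 - Psicdf c q x <= 2^-1 * (q + q^-1) * expR (- (c * (x - 1))).
Proof.
move=> c0 q0; have qV0 : 0 < q^-1 by rewrite invr_gt0.
have /andP[a1 a2] := Gcdf_upper _ _ x c0 q0.
have /andP[b1 b2] := Gcdf_upper _ _ x c0 qV0.
rewrite /Psicdf.
by apply/andP; split; [|rewrite -mulrA mulrDl]; lra.
Qed.

Lemma Psicdf_tails (c q T : R) : 0 < c -> 0 < q ->
  Psicdf c q (- T) + (1 - Psicdf c q T) <= (q + q^-1) * expR (- (c * (T - 1))).
Proof.
move=> c0 q0.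
have /andP[_ h1] := Psicdf_lower _ _ (- T) c0 q0.
have /andP[_ h2] := Psicdf_upper _ _ T c0 q0.
(* The lower tail at [- T] has the same exponent as the upper tail at [T], so the two halves add
   up. *)
rewrite (_ : c * (- T + 1) = - (c * (T - 1))) in h1; last by ring.
by rewrite -!mulrA in h1 h2; lra.
Qed.

Lemma cvg_expR_tail (c C : R) : 0 < c ->
  C * expR (- (c * (x - 1))) @[x --> +oo] --> (0 : R).
Proof.
move=> c0; rewrite -[X in _ --> X](mulr0 C); apply: cvgMr.
apply: (@cvg_comp _ _ _ (fun x : R => c * (x - 1)) (fun y => expR (- y)) _
  (pinfty_nbhs R)); last exact: cvgr_expR.
apply/cvgryPge => A; near=> x; rewrite -ler_pdivrMl// lerBrDr.
by near: x; apply: nbhs_pinfty_ge; exact: num_real.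
Unshelve. all: by end_near. Qed.

Lemma Psi_density (B beta q : R) : 1 < B -> 0 < beta -> 0 < q ->
  is_density (Psi B beta q) (Psicdf (beta * ln B) q).
Proof.
move=> B1 beta0 q0; have qV0 : 0 < q^-1 by rewrite invr_gt0.
set c := beta * ln B; have c0 : 0 < c by rewrite mulr_gt0// ln_gt0.
pose C := 2^-1 * (q + q^-1); split.
- by move=> x; rewrite /Psi mulr_ge0 ?invr_ge0// addr_ge0// G_ge0.
- by move=> x; apply: cvgMr; apply: cvgD; exact: G_continuous.
- move=> x; have h := is_deriveD (is_derive_Gcdf B beta q x B1 beta0 q0)
    (is_derive_Gcdf B beta q^-1 x B1 beta0 qV0).
  exact: (is_deriveZ 2^-1 h).
(* Both limits are squeezed between 0 and the exponential tail bounds; the one at [-oo] is first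
   reflected to [+oo]. *)
- have h : 1 - Psicdf c q x @[x --> +oo] --> (0 : R).
    apply: (squeeze_cvgr _ (cvg_cst 0) (cvg_expR_tail c C c0)).
    by near=> x; exact: Psicdf_upper.
  rewrite (_ : Psicdf c q = fun x => 1 - (1 - Psicdf c q x)).
    by rewrite -[X in _ --> X]subr0; apply: cvgB h; exact: cvg_cst.
  by apply/funext => x; rewrite subKr.
- apply/cvgNy_compNP.
  apply: (squeeze_cvgr _ (cvg_cst 0) (cvg_expR_tail c C c0)).
  near=> x; rewrite /= (_ : - (c * (x - 1)) = c * (- x + 1)); last by ring.
  exact: Psicdf_lower.
Unshelve. all: by end_near. Qed.

(** * Pointwise error of the quadrature operator *)

Lemma weighted_average_dist (r : nat) (w g : nat -> R) (y d : R) :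
  (forall j, (1 <= j <= r)%N -> 0 <= w j) ->
  \sum_(1 <= j < r.+1) w j = 1 ->
  (forall j, (1 <= j <= r)%N -> `|g j - y| <= d) ->
  `|\sum_(1 <= j < r.+1) w j * g j - y| <= d.
Proof.
move=> w0 w1 gd.
(* As the weights sum to 1, [y] and [d] become weighted sums too, and the comparison is termwise. *)
rewrite -[y in X in X <= _]mul1r -[d]mul1r -w1 !mulr_suml -sumrB.
apply: (le_trans (ler_norm_sum _ _ _)); apply: ler_sum_nat => j jr.
by rewrite -mulrBr normrM ger0_norm ?w0// ler_wpM2l ?w0// gd.
Qed.

(** This is [density_approx] centred at [n * x]. Leaving [om], [M] and [T] free lets it serve both
    the quantitative bound, with [T] depending on [n], and the limit, with [T] fixed. *)
Lemma quadrature_op_error (q beta B : R) (r : nat) (w : nat -> R) (n : nat)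
    (f : R -> R) (om M T x : R) :
  0 < q -> 0 < beta -> 1 < B -> (0 < r)%N ->
  (forall j, (1 <= j <= r)%N -> 0 <= w j) ->
  \sum_(1 <= j < r.+1) w j = 1 ->
  (0 < n)%N -> continuous f -> (forall y, `|f y| <= M) -> 0 <= om ->
  (forall y z, `|y - z| <= n%:R^-1 + T / n%:R -> `|f y - f z| <= om) ->
  `|quadrature_op B beta q r w n f x - f x| <=
    om + 2 * (q + q^-1) * M * expR (- (beta * ln B * (T - 1))).
Proof.
move=> q0 beta0 B1 r0 w0 w1 n0 cf fM om0 fom.
have c0 : 0 < beta * ln B by rewrite mulr_gt0// ln_gt0.
have nR : 0 < n%:R :> R by rewrite ltr0n.
have rR : 0 < r%:R :> R by rewrite ltr0n.
have M0 : 0 <= M by apply: le_trans (fM 0).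
pose S v := \sum_(1 <= j < r.+1) w j * f (v / n%:R + j%:R / (n%:R * r%:R)).
have mS : measurable_fun setT S.
  apply: measurable_sum => j; apply: continuous_measurable_fun.
  move=> v; apply: cvgMr.
  apply: (@continuous_comp _ _ _ (fun v : R => v / n%:R + j%:R / (n%:R * r%:R)) f).
    by apply: cvgD; [apply: cvgMl; exact: cvg_id|exact: cvg_cst].
  exact: cf.
have Som v : `|n%:R * x - v| <= T -> `|S v - f x| <= om.
  move=> vT; apply: weighted_average_dist => // j /andP[j1 jr]; apply: fom.
  (* The displacement splits into [j / r / n], at most [1 / n] because [j <= r], and
     [(n * x - v) / n], at most [T / n] in absolute value. *)
  have -> : v / n%:R + j%:R / (n%:R * r%:R) - x =
    j%:R / r%:R / n%:R - (n%:R * x - v) / n%:R by field; lra.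
  apply: (le_trans (ler_normB _ _)); apply: lerD.
    rewrite ger0_norm ?divr_ge0//.
    by rewrite ler_pdivrMr// mulVf ?gt_eqF// ler_pdivrMr// mul1r ler_nat.
  by rewrite normrM (ger0_norm (_ : 0 <= n%:R^-1)) ?invr_ge0 ?(ltW nR)// ler_pM2r ?invr_gt0.
have SM v : `|S v - f x| <= 2 * M.
  apply: weighted_average_dist => // j _; apply: (le_trans (ler_normB _ _)).
  by rewrite (_ : 2 * M = M + M); [exact: lerD|ring].
have := density_approx _ _ S (n%:R * x) (f x) T om (2 * M)
  (Psi_density B beta q B1 beta0 q0) mS om0 Som SM.
move=> /le_trans; apply; rewrite lerD2l.
have := Psicdf_tails (beta * ln B) q T c0 q0.
move=> /(ler_wpM2l (_ : 0 <= 2 * M)) h.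
apply: (le_trans (h _)); first by rewrite mulr_ge0.
by rewrite le_eqVlt; apply/orP; left; apply/eqP; ring.
Qed.

(** * Finiteness of the modulus and the supremum norm *)

Lemma bounded_fun_norm_le (f : R -> R) :
  bounded_fun f -> exists M, forall x, `|f x| <= M.
Proof.
(* [bounded_fun] only provides bounds strictly above its threshold [M], hence [M + 1]. *)
move=> [M [_ hM]]; exists (M + 1) => x.
by apply: (hM (M + 1)) => //; rewrite ltrDl.
Qed.

Lemma modulus_fin (f : R -> R) (theta : R) :
  bounded_fun f -> 0 <= theta -> modulus f theta \is a fin_num.
Proof.
move=> /bounded_fun_norm_le[M fM] t0; rewrite fin_numElt; apply/andP; split.
  apply: (@lt_le_trans _ _ 0%E); first exact: ltNyr.
  by apply: ereal_sup_ubound; exists (0, 0) => /=; rewrite subrr normr0.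
apply: (@le_lt_trans _ _ (M + M)%:E); last exact: ltry.
apply: ge_ereal_sup => _ [[y z] _ <-]; rewrite lee_fin.
by apply: (le_trans (ler_normB _ _)); exact: lerD.
Qed.

Lemma le_modulus (f : R -> R) (theta y z : R) :
  `|y - z| <= theta -> (`|f y - f z|%:E <= modulus f theta)%E.
Proof. by move=> yz; apply: ereal_sup_ubound; exists (y, z). Qed.

Lemma le_supnorm (f : R -> R) (x : R) :
  (`|f x|%:E <= supnorm f)%E.
Proof. by apply: ereal_sup_ubound; exists x. Qed.

Lemma supnorm_fin (f : R -> R) :
  bounded_fun f -> supnorm f \is a fin_num.
Proof.
move=> /bounded_fun_norm_le[M fM]; rewrite fin_numElt; apply/andP; split.
  apply: lt_le_trans (le_supnorm f 0); exact: ltNyr.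
apply: (@le_lt_trans _ _ M%:E); last exact: ltry.
by apply: ge_ereal_sup => _ [x _ <-]; rewrite lee_fin.
Qed.

(** * Uniform convergence for uniformly continuous functions *)

Lemma uniform_cvg_dist (F : nat -> R -> R) (f : R -> R) :
  (forall e, 0 < e -> \forall n \near \oo, forall x, `|F n x - f x| < e) ->
  {uniform, F n @[n --> \oo] --> f}.
Proof.
(* A uniform neighbourhood of [f] comes from an entourage, which contains all pairs at distance
   below some [e]. *)
move=> h P /uniform_nbhs[E [entE EP]].
move: entE; rewrite -entourage_ballE => -[e /= e0 eE].
near=> n; apply: EP => x _; apply: eE => /=.
rewrite /ball/= distrC; move: x; near: n; exact: h.
Unshelve. all: by end_near. Qed.

Lemma unif_continuous_continuous (f : R -> R) :
  unif_continuous f -> continuous f.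
Proof.
move=> /unif_continuousP uf x; apply/cvgrPdist_lt => e /uf[d d0 fd].
apply: filterS (nbhsx_ballx x d d0) => z; exact: (fd (x, z)).
Qed.

Lemma quadrature_op_uniform (q beta B : R) (r : nat) (w : nat -> R)
    (f : R -> R) :
  0 < q -> 0 < beta -> 1 < B -> (0 < r)%N ->
  (forall j, (1 <= j <= r)%N -> 0 <= w j) ->
  \sum_(1 <= j < r.+1) w j = 1 -> C_UB f ->
  forall e, 0 < e -> \forall n \near \oo,
    forall x, `|quadrature_op B beta q r w n f x - f x| < e.
Proof.
move=> q0 beta0 B1 r0 w0 w1 [ucf bf] e e0.
have c0 : 0 < beta * ln B by rewrite mulr_gt0// ln_gt0.
have [M fM] := bounded_fun_norm_le _ bf.
have e30 : 0 < e / 3 by rewrite divr_gt0.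
have cf : continuous f by exact: unif_continuous_continuous.
move/unif_continuousP : ucf => /(_ _ e30)[d d0 fd].
(* [T] is fixed by the tail term alone, before [n] is chosen. *)
have [T [T0 hT]] : exists T, 0 < T /\
    2 * (q + q^-1) * M * expR (- (beta * ln B * (T - 1))) < e / 3.
  have := cvgr_lt _ (cvg_expR_tail (beta * ln B) (2 * (q + q^-1) * M) c0) _ e30.
  move=> hT; near (pinfty_nbhs R) => T; exists T; split; last by near: T; exact: hT.
  by near: T; apply: nbhs_pinfty_gt; exact: num_real.
near=> n => x.
have n0 : (0 < n)%N by near: n; exact: nbhs_infty_gt.
have nR : 0 < n%:R :> R by rewrite ltr0n.
(* The radius is [(1 + T) / n], so it suffices that [n] exceeds [(1 + T) / d]. *)
have Tn : n%:R^-1 + T / n%:R < d.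
  rewrite -[X in X + _]mul1r -mulrDl ltr_pdivrMr// mulrC -ltr_pdivrMr//.
  by near: n; exact: nbhs_infty_gtr.
apply: le_lt_trans (quadrature_op_error _ _ _ r w n f (e / 3) M T x
  q0 beta0 B1 r0 w0 w1 n0 cf fM (ltW e30) _) _; last by lra.
move=> y z yz; apply/ltW/(fd (y, z)) => /=.
exact: le_lt_trans yz Tn.
Unshelve. all: by end_near. Qed.

End Quadrature.

Theorem theorem4 (R : realType) (q beta B : R) (r : nat) (w : nat -> R)
    (q_gt0 : 0 < q) (beta_gt0 : 0 < beta) (B_gt1 : 1 < B)
    (r_gt0 : (0 < r)%N)
    (w_ge0 : forall j : nat, (1 <= j <= r)%N -> 0 <= w j)
    (w_sum1 : \sum_(1 <= j < r.+1) w j = 1) :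
  (forall (alpha : R) (n : nat) (f : R -> R),
      0 < alpha -> alpha < 1 ->
      (0 < n)%N -> 2 < n%:R `^ (1 - alpha) ->
      C_B f ->
      let E : \bar R :=
        (modulus f (n%:R^-1 + (n%:R `^ alpha)^-1)
         + (2 * (q + q^-1))%:E * supnorm f
           * ((B `^ (beta * (n%:R `^ (1 - alpha) - 1)))^-1)%:E)%E in
      (forall x : R,
          (`|quadrature_op B beta q r w n f x - f x|%R%:E <= E)%E) /\
      (supnorm (fun x : R => (quadrature_op B beta q r w n f x - f x)%R)
         <= E)%E) /\
  (forall f : R -> R,
      C_UB f ->
      (forall x : R,
          quadrature_op B beta q r w n f x @[n --> \oo] --> f x) /\
      {uniform, quadrature_op B beta q r w n f @[n --> \oo] --> f}).
Proof.
split=> [alpha n f alpha0 alpha1 n0 _ [cf bf] E|f fUB]; last first.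
  have uf := quadrature_op_uniform q beta B r w f q_gt0 beta_gt0 B_gt1 r_gt0 w_ge0 w_sum1 fUB.
  split=> [x|]; last exact: uniform_cvg_dist uf.
  apply/cvgrPdist_lt => e e0; near=> n; rewrite distrC; move: x.
  by near: n; exact: uf.
suff EP x : (`|quadrature_op B beta q r w n f x - f x|%:E <= E)%E.
  by split=> //; apply: ge_ereal_sup => _ [x _ <-].
have nR : 0 < n%:R :> R by rewrite ltr0n.
pose T : R := n%:R `^ (1 - alpha).
(* This identity turns the radius in [E] into the form [n^-1 + T / n] of the error lemma. *)
have ET : (n%:R `^ alpha)^-1 = T / n%:R.
  rewrite -powRN -powR_inv1 ?ltW// -powRD; last by apply/implyP => _; rewrite gt_eqF.
  by congr powR; lra.
have th0 : 0 <= n%:R^-1 + T / n%:R :> R.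
  by rewrite addr_ge0 ?invr_ge0 ?divr_ge0 ?powR_ge0// ltW.
have EB : (B `^ (beta * (T - 1)))^-1 = expR (- (beta * ln B * (T - 1))).
  rewrite -powRN /powR gt_eqF ?(lt_trans ltr01)//; congr expR; ring.
(* Boundedness of [f] makes both suprema finite, so their real values can serve as [om] and [M]. *)
rewrite /E -/T ET EB -(fineK (modulus_fin _ _ bf th0)) -(fineK (supnorm_fin _ bf)).
rewrite lee_fin; apply: quadrature_op_error => //.
- by move=> y; rewrite -lee_fin fineK ?supnorm_fin//; exact: le_supnorm.
- rewrite fine_ge0//; apply: le_trans (le_modulus f _ 0 0 _); last by rewrite subrr normr0.
  by rewrite lee_fin.
- by move=> y z yz; rewrite -lee_fin fineK ?modulus_fin//; exact: le_modulus.
Unshelve. all: by end_near. Qed.
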